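(* Let $\mathcal{H}$ be a complex Hilbert space, $T \in \mathcal{B}(\mathcal{H})$, $q \in \mathbb{C}$ with $|q|\le 1$, and let $\phi$ be an Orlicz function. Then \begin{align*} \phi \left(w_q(T)\right) \le & \int_0^1 \phi \left( \left(\sqrt{2}\,t|q|+2(1-t)\sqrt{1-|q|^2}\right) \| TT^*+T^*T\|^{\frac{1}{2}}\right)dt\\ \le & \frac{1}{2}\left(\phi \left( \sqrt{2}\,|q|\,\|TT^*+T^*T\|^{\frac{1}{2}}\right) + \phi \left( 2\sqrt{1-|q|^2}\,\|TT^*+T^*T\|^{\frac{1}{2}}\right)\right). \end{align*}
   Context: $\mathcal{B}(\mathcal{H})$ is the $C^*$-algebra of all bounded linear operators on $\mathcal{H}$, with operator norm $\|\cdot\|$; the inner product is linear in its first argument. For $T\in\mathcal{B}(\mathcal{H})$ and $|q|\le 1$, the $q$-numerical radius is $w_q(T)=\sup\{|\langle Tx,y\rangle| : x,y\in\mathcal{H},\ \|x\|=\|y\|=1,\ \langle x,y\rangle=q\}$; it is understood that this set is nonempty, i.e. $\dim\mathcal{H}\ge 1$ if $|q|=1$ and $\dim\mathcal{H}\ge 2$ if $|q|<1$. An Orlicz function (non-degenerate) is a continuous, convex, increasing function $\phi:[0,\infty)\to[0,\infty)$ with $\phi(0)=0$, $\phi(t)>0$ for every $t>0$, and $\lim_{t\to\infty}\phi(t)=\infty$. *)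

(* Defs.v *)
From HB Require Import structures.
From mathcomp Require Import all_boot all_order all_algebra.
From mathcomp Require Import all_classical all_reals all_analysis.
From mathcomp Require Import complex.

Set Implicit Arguments.
Unset Strict Implicit.
Unset Printing Implicit Defensive.

Import Order.TTheory GRing.Theory Num.Def Num.Theory.
Import numFieldNormedType.Exports.

Local Open Scope classical_set_scope.
Local Open Scope ring_scope.
Local Open Scope complex_scope.

(* A [{dot H for conjC}] is linear in its first argument, conjugate-linear in
   its second, hermitian and positive definite. *)
HB.mixin Record CompleteNormed_isHilbert (R : realType) H
    of CompleteNormedModule R[i] H := {
  inner : {dot H for @conjC R[i]};
  inner_norm : forall x : H, inner x x = `|x| ^+ 2
}.

#[short(type="hilbertType")]
HB.structure Definition Hilbert (R : realType) :=
  {H of CompleteNormed_isHilbert R H & CompleteNormedModule R[i] H}.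

(* Norms over R[i] take values in the nonnegative reals of R[i]; [rnorm] is the
   same quantity as an element of R. *)
Definition rnorm (R : realType) (V : normedZmodType R[i]) (x : V) : R :=
  complex.Re `|x|.

Definition bounded_operator (R : realType) (H : hilbertType R)
    (T : {linear H -> H}) : Prop :=
  exists M : R, forall x : H, rnorm (T x) <= M * rnorm x.

Definition opnorm (R : realType) (H : hilbertType R) (T : H -> H) : R :=
  sup [set rnorm (T x) | x in [set x : H | rnorm x <= 1]].

(* [adjoint T y] is the vector z such that <T x, y> = <x, z> for all x; it is
   unique since the inner product is definite, and for T bounded and linear it
   exists by the Riesz representation theorem, so that the default value 0 of
   [xget] is then irrelevant. *)
Definition adjoint (R : realType) (H : hilbertType R) (T : H -> H) (y : H) : H :=
  xget 0 [set z : H | forall x : H, inner (T x) y = inner x z].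

Definition q_values (R : realType) (H : hilbertType R) (q : R[i])
    (T : H -> H) : set R :=
  [set r | exists x y : H,
     [/\ rnorm x = 1, rnorm y = 1, inner x y = q & r = rnorm (inner (T x) y)]].

Definition q_numerical_radius (R : realType) (H : hilbertType R) (q : R[i])
    (T : H -> H) : R :=
  sup (q_values q T).

(* Orlicz functions live on [0, +oo[; the values of phi on negative numbers are
   unconstrained. *)
Definition orlicz (R : realType) (phi : R -> R) : Prop :=
  [/\ [/\ forall t : R, 0 <= t -> 0 <= phi t,
          {within `[0, +oo[, continuous phi},
          convex_function (E := R^o) `[0, +oo[ phi
        & {in `[0, +oo[ &, {homo phi : s t / s <= t}}],
      phi 0 = 0,
      forall t : R, 0 < t -> 0 < phi t
    & phi t @[t --> +oo] --> +oo].

(* Main.v *)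
From HB Require Import structures.
Require Import Defs.
From mathcomp Require Import all_boot all_order all_algebra.
From mathcomp Require Import all_classical all_reals all_analysis.
From mathcomp Require Import complex.
From mathcomp Require Import ring lra.

Import Order.TTheory GRing.Theory Num.Def Num.Theory.
Import numFieldNormedType.Exports.

Local Open Scope classical_set_scope.
Local Open Scope ring_scope.
Local Open Scope complex_scope.

(** The integrand is [phi] along the segment from [b = 2 sqrt(1 - |q|^2) N] to
    [a = sqrt 2 |q| N], where [N = ||TT* + T*T||^(1/2)].  By the
    Hermite-Hadamard inequality, its mean lies between [phi ((a + b) / 2)] and
    [(phi a + phi b) / 2] ([hermite_hadamard]).  The upper bound is the second
    inequality; since [phi] is nondecreasing on the nonnegative reals, the
    first one follows from [w_q(T) <= (a + b) / 2], that is,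
    [w_q(T) <= (sqrt 2 / 2 |q| + sqrt(1 - |q|^2)) N] ([q_values_le]).

    For that bound, let [x], [y] be unit vectors with [<x, y> = q], and write
    [y = q^* x + w] with [w] orthogonal to [x], so that
    [|w| = sqrt(1 - |q|^2)].  Then [<Tx, y> = q <Tx, x> + <Tx, w>].  Everything
    else comes from [|Tx|^2 + |T*x|^2 = <(TT* + T*T)x, x> <= N^2]
    ([sqr_rnormD_adjoint_le]): it gives [|Tx| <= N], and, since [|<Tx, x>|] is at
    most both [|Tx|] and [|T*x|], also [2 |<Tx, x>|^2 <= N^2].

    The formula for [|Tx|^2 + |T*x|^2] uses that [adjoint T] is a genuine
    adjoint, hence the Riesz representation theorem ([riesz_representation]).  A bounded
    functional [f] is represented by the minimiser of
    [J x = |x|^2 - 2 Re (f x)]: the parallelogram law makes minimising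
    sequences Cauchy, completeness provides a limit [z], and the first-order
    condition along [h] and [-h] reads [Re <h, z> = Re (f h)]. *)

Local Notation Re := complex.Re.

(** * Real-valued norms *)

Section RealParts.
Context {R : realType}.
Implicit Types a b : R[i].

Lemma ReD a b : Re (a + b) = Re a + Re b.
Proof. by case: a b => [? ?] [? ?]. Qed.

Lemma ReN a : Re (- a) = - Re a.
Proof. by case: a => [? ?]. Qed.

Lemma ReZ (r : R) a : Re (r%:C * a) = r * Re a.
Proof. by case: a => x y; rewrite /= mul0r subr0. Qed.

Lemma ReJ a : Re (conjC a) = Re a.
Proof. by case: a => [? ?]. Qed.

End RealParts.

Section RealNorm.
Context {R : realType} {V : normedModType R[i]}.
Implicit Types x y : V.

Lemma rnormE x : `|x| = (rnorm x)%:C.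
Proof. by rewrite RRe_real// ger0_real. Qed.

Lemma rnorm_ge0 x : 0 <= rnorm x.
Proof. by rewrite -ler0c -rnormE. Qed.

Lemma ler_rnormD x y : rnorm (x + y) <= rnorm x + rnorm y.
Proof. by rewrite -lecR rmorphD /= -!rnormE ler_normD. Qed.

Lemma rnormN x : rnorm (- x) = rnorm x.
Proof. by rewrite /rnorm normrN. Qed.

End RealNorm.

Section ComplexModulus.
Context {R : realType}.
Implicit Types a b : R[i].

Lemma rnormcE a : `|a| = (rnorm a)%:C.
Proof. exact: (@rnormE R R[i]^o). Qed.

Lemma ler_Re_rnorm a : Re a <= rnorm a.
Proof.
by apply: le_trans (ler_norm _) _; rewrite -lecR -rnormcE normc_ge_Re.
Qed.

Lemma rnormZ (V : normedModType R[i]) a (x : V) :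
  rnorm (a *: x) = rnorm a * rnorm x.
Proof. by apply: complexI; rewrite rmorphM /= -rnormE normrZ rnormE rnormcE. Qed.

End ComplexModulus.

(** * Inner products *)

(** Pythagoras applied to the splitting of [u] into its projection [a *: v] and
    the orthogonal remainder. *)
Lemma dot_CauchySchwarz (C : numClosedFieldType) (U : lmodType C)
    (form : {dot U for @conjC C}) (u v : U) :
  `|form u v| ^+ 2 <= form u u * form v v.
Proof.
have [->|v0] := eqVneq v 0.
  by rewrite !linear0r normr0 expr0n.
set a := form u v / form v v.
have vv0 : form v v != 0 by rewrite dnorm_eq0.
have ov : form (u - a *: v) v = 0.
  by rewrite linearBl/= linearZl_LR /= divfK ?subrr.
have -> : form u u = form (u - a *: v) (u - a *: v) + `|a| ^+ 2 * form v v.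
  by rewrite -dnormZ -hnormDd ?subrK// linearZr_LR /= ov mulr0.
have -> : form u v = a * form v v by rewrite divfK.
rewrite normrM (ger0_norm (dnorm_ge0 _ _)) exprMn expr2 mulrDl.
rewrite [_ ^+ 2]expr2 -!mulrA.
by rewrite lerDr mulr_ge0 ?dnorm_ge0.
Qed.

Section Hilbert.
Context {R : realType} {H : hilbertType R}.
Implicit Types x y z : H.

Lemma innerDl x y z : inner (x + y) z = inner x z + inner y z.
Proof. exact: linearDl. Qed.

Lemma innerDr x y z : inner x (y + z) = inner x y + inner x z.
Proof. exact: linearDr. Qed.

Lemma innerZl a x y : inner (a *: x) y = a * inner x y.
Proof. exact: linearZl_LR. Qed.

Lemma innerNl x y : inner (- x) y = - inner x y.
Proof. exact: linearNl. Qed.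

Lemma innerNr x y : inner x (- y) = - inner x y.
Proof. exact: linearNr. Qed.

Lemma innerZr a x y : inner x (a *: y) = conjC a * inner x y.
Proof. exact: linearZr_LR. Qed.

Lemma innerC x y : inner x y = conjC (inner y x).
Proof. by rewrite hermC mul1r. Qed.

Lemma inner_rnorm x : inner x x = (rnorm x ^+ 2)%:C.
Proof. by rewrite inner_norm rnormE rmorphXn. Qed.

Lemma ler_rnorm_inner x y : rnorm (inner x y) <= rnorm x * rnorm y.
Proof.
rewrite -(@ler_pXn2r _ 2) ?nnegrE ?mulr_ge0 ?rnorm_ge0//; last first.
  exact: (@rnorm_ge0 R R[i]^o).
rewrite -lecR exprMn rmorphXn /= -rnormcE rmorphM /= -!inner_rnorm.
exact: dot_CauchySchwarz.
Qed.

Lemma sqr_rnormD x y :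
  rnorm (x + y) ^+ 2 = rnorm x ^+ 2 + rnorm y ^+ 2 + 2 * Re (inner x y).
Proof.
apply: complexI; rewrite -inner_rnorm innerDl !innerDr !inner_rnorm (innerC y x).
have xyE : inner x y + conjC (inner x y) = (2 * Re (inner x y))%:C.
  case: (inner x y) => a b; apply/eqP; rewrite eq_complex /= subrr eqxx andbT.
  by apply/eqP; ring.
by rewrite !rmorphD /= -xyE; ring.
Qed.

Lemma parallelogram x y :
  rnorm (x + y) ^+ 2 + rnorm (x - y) ^+ 2 = 2 * (rnorm x ^+ 2 + rnorm y ^+ 2).
Proof.
by rewrite !sqr_rnormD rnormN innerNr ReN; ring.
Qed.

(** * The Riesz representation theorem *)

Section Riesz.
Variables (f : {scalar H}) (M : R).
Hypothesis fM : forall x, rnorm (f x) <= M * rnorm x.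

(** Up to a constant, [J x] is the squared distance from [x] to the vector
    that represents [f]. *)
Let J x := rnorm x ^+ 2 - 2 * Re (f x).
Let m := inf (range J).

Let J_bounded : has_lbound (range J).
Proof.
exists (- M ^+ 2) => _ [x _ <-]; rewrite /J.
have h := le_trans (ler_Re_rnorm (f x)) (fM x).
have := sqr_ge0 (rnorm x - M); nra.
Qed.

Let mJ x : m <= J x.
Proof. by apply: ge_inf => //; exists x. Qed.

Let near_inf (e : R) : 0 < e -> exists x, J x < m + e.
Proof.
move=> e0; have [|_ [x _ <-] ?] := @inf_adherent _ (range J) _ e0; last by exists x.
by split=> //; exists (J 0), 0.
Qed.

(** The parallelogram law for [x] and [y], together with [m <= J] at their
    midpoint. *)
Let minimizers_close (d : R) x y : J x < m + d -> J y < m + d ->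
  rnorm (x - y) ^+ 2 <= 4 * d.
Proof.
move=> xd yd; have := mJ (2^-1%:C *: (x + y)).
have fE : f (2^-1%:C *: (x + y)) = 2^-1%:C * (f x + f y).
  by rewrite linearZ linearD.
rewrite /J fE rnormZ ReZ ReD.
have -> : rnorm (2^-1%:C : R[i]) = 2^-1.
  by apply: complexI; rewrite -rnormcE ger0_norm// ler0c invr_ge0.
have := parallelogram x y; rewrite exprMn.
move: xd yd; rewrite /J; lra.
Qed.

(** The approximate minimisers [x] stand in for [z]: with the error in [J]
    quadratic in the distance, the first-order condition can be read off at
    [x] and passed to [z] without the continuity of [J]. *)
Let near_minimizer : exists z, forall e : R, 0 < e ->
  exists x, rnorm (z - x) <= e /\ J x <= m + e ^+ 2.
Proof.
have inv_gt0 n : 0 < (n.+1%:R^-1 : R) ^+ 2 by rewrite exprn_gt0 ?invr_gt0.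
have /boolp.choice [u uJ] : forall n : nat, exists x, J x < m + (n.+1%:R^-1) ^+ 2.
  by move=> n; exact: near_inf.
have small (e : R) : 0 < e -> \forall n \near \oo, (n.+1%:R^-1 : R) < e.
  by move=> e0; near=> n; near: n; exact: near_infty_natSinv_lt (PosNum e0).
have uC : cauchy (u @ \oo).
  apply: cauchy_exP => e e0.
  have eE : (Re e)%:C = e by rewrite RRe_real// gtr0_real.
  have re0 : 0 < Re e by rewrite -ltcR eE.
  have re20 : 0 < Re e / 2 by rewrite divr_gt0.
  have [n _ ne] := small _ re20.
  exists (u n), n => // k /= nk.
  rewrite -ball_normE /ball_ /= rnormE -eE ltcR.
  rewrite -(@ltr_pXn2r _ 2) ?nnegrE ?rnorm_ge0 ?(ltW re0)//.
  have kn : (k.+1%:R^-1 : R) ^+ 2 <= n.+1%:R^-1 ^+ 2.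
    by rewrite ler_pXn2r ?nnegrE ?invr_ge0// lef_pV2 ?posrE// ler_nat.
  have uk := lt_le_trans (uJ k) (lerD (lexx m) kn).
  have uh := minimizers_close _ _ _ (uJ n) uk.
  apply: (le_lt_trans uh).
  have := ne n (leqnn n); have : 0 <= (n.+1%:R^-1 : R) by rewrite invr_ge0.
  by rewrite /=; set t := _^-1; nra.
have /cauchy_cvgP uz := uC.
exists (lim (u @ \oo)) => e e0.
have e0' : 0 < e%:C by rewrite ltcR.
have uze := @cvgr_dist_lt _ _ _ _ _ _ _ uz _ e0'.
near \oo => n; exists (u n); split.
  rewrite -lecR -rnormE ltW//; near: n; exact: uze.
apply/ltW/(lt_trans (uJ n)); rewrite ltrD2l ltr_pXn2r ?nnegrE ?invr_ge0 ?(ltW e0)//.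
by near: n; exact: small.
Unshelve. all: by end_near.
Qed.

(** Optimality of [z] in the direction [h] only controls real parts; the
    imaginary parts come from applying it to ['i *: x]. *)
Lemma riesz_representation : exists z, forall x, f x = inner x z.
Proof.
have [z zJ] := near_minimizer; exists z => x.
have Re_le h : Re (inner h z) <= Re (f h).
  apply/ler_addgt0Pr => d d0.
  (* Comparing J y with J (y - e h), and moving from y to z, costs e C at most. *)
  set C := rnorm h + (rnorm h ^+ 2 + 1).
  have C0 : 0 < C.
    by rewrite ltr_wpDl ?rnorm_ge0// ltr_wpDl ?sqr_ge0.
  have e0 : 0 < d / C by rewrite divr_gt0.
  set e := d / C in e0; have eC : e * C = d by rewrite divfK ?gt_eqF.
  have [y [zy yJ]] := zJ _ e0.
  have := le_trans yJ (lerD (mJ (y - e%:C *: h)) (lexx _)).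
  have fE : f (y - e%:C *: h) = f y - e%:C * f h by rewrite linearB linearZ.
  have iE : inner y (- (e%:C *: h)) = - (e%:C * inner y h).
    by rewrite innerNr innerZr; congr (- (_ * _)); exact: conjc_real.
  have hE : Re (inner h z) = Re (inner y h) + Re (inner h (z - y)).
    by rewrite -[Re (inner y h)]ReJ -innerC -ReD -innerDr subrKC.
  have hzy := ler_Re_rnorm (inner h (z - y)).
  have := le_trans hzy (le_trans (ler_rnorm_inner _ _) (ler_wpM2l (rnorm_ge0 h) zy)).
  rewrite /J fE sqr_rnormD iE rnormN rnormZ !(ReD, ReN, ReZ).
  have -> : rnorm (e%:C : R[i]) = e.
    by apply: complexI; rewrite -rnormcE ger0_norm// ler0c ltW.
  rewrite hE -eC /C; set a := Re (inner y h); set b := Re (f h).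
  set c := Re (inner h _); set r := rnorm h => cr hJ.
  have {}hJ : e * (2 * (a - b)) <= e * (e * (r ^+ 2 + 1)) by move: hJ; lra.
  rewrite ler_pM2l// in hJ.
  have : 0 <= e * (r ^+ 2 + 1) by rewrite mulr_ge0 ?(ltW e0)// addr_ge0 ?sqr_ge0.
  by move: cr hJ; lra.
have Re_eq h : Re (inner h z) = Re (f h).
  apply/eqP; rewrite eq_le Re_le/=; have := Re_le (- h).
  have -> : f (- h) = - f h by exact: linearN.
  by rewrite innerNl !ReN lerN2.
have := Re_eq ('i%C *: x).
rewrite innerZl; have -> : f ('i%C *: x) = 'i%C * f x by rewrite linearZ.
have := Re_eq x; case: (inner x z) (f x) => [a b] [a' b'] /=.
by rewrite !mul0r !mul1r !sub0r => -> /oppr_inj ->.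
Qed.
End Riesz.

(** * The adjoint and the operator norm *)

Section Adjoint.
Variables (T : {linear H -> H}) (M : R).
Hypothesis TM : forall x, rnorm (T x) <= M * rnorm x.

Let M_ge0 x : 0 <= M * rnorm x.
Proof. exact: le_trans (rnorm_ge0 _) (TM x). Qed.

Lemma adjointP x y : inner (T x) y = inner x (adjoint T y).
Proof.
have [z zP] : exists z, forall x, inner (T x) y = inner x z.
  pose f x : R[i] := inner (T x) y.
  have f_lin : scalar f.
    by move=> a u v; rewrite /f linearP innerDl innerZl.
  pose fL : {scalar H} := HB.pack f (GRing.isLinear.Build _ _ _ _ f f_lin).
  apply: (@riesz_representation fL (M * rnorm y)) => u.
  rewrite mulrAC; apply: le_trans (ler_rnorm_inner _ _) _.
  by rewrite ler_wpM2r ?rnorm_ge0.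
move: x; apply: (@xgetPex _ 0 [set z | forall x, inner (T x) y = inner x z]).
by exists z.
Qed.

(** [|T*y|^2 = <T(T*y), y> <= M |T*y| |y|], and one factor [|T*y|] cancels. *)
Lemma ler_rnorm_adjoint y : rnorm (adjoint T y) <= M * rnorm y.
Proof.
set z := adjoint T y.
have [z0|z0] := leP (rnorm z) 0; first exact: le_trans z0 (M_ge0 y).
rewrite -(ler_pM2r z0) mulrAC -expr2.
have -> : rnorm z ^+ 2 = Re (inner (T z) y) by rewrite adjointP inner_rnorm.
apply: le_trans (ler_Re_rnorm _) (le_trans (ler_rnorm_inner _ _) _).
by rewrite ler_wpM2r ?rnorm_ge0.
Qed.

Let S : H -> H := (T \o adjoint T) \+ (adjoint T \o T).

(** [opnorm] is a supremum in [R], so it dominates the values of [|S x|] only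
    once these are known to be bounded. *)
Let ler_rnormS x : rnorm x <= 1 -> rnorm (S x) <= opnorm S.
Proof.
move=> x1; apply: ub_le_sup; last by exists x.
have bound2 (A B : H -> H) u : (forall v, rnorm (A v) <= M * rnorm v) ->
    (forall v, rnorm (B v) <= M * rnorm v) -> rnorm u <= 1 ->
    rnorm (A (B u)) <= M ^+ 2.
  move=> AM BM u1; apply: le_trans (AM _) _.
  have [M0|M0] := leP 0 M.
    by rewrite expr2 ler_wpM2l// (le_trans (BM u))// ler_piMr.
  by rewrite (le_trans _ (sqr_ge0 M))// mulr_le0_ge0 ?rnorm_ge0 ?ltW.
exists (M ^+ 2 + M ^+ 2) => _ [u /= u1 <-].
apply: le_trans (ler_rnormD _ _) (lerD _ _).
  by apply: (bound2 T (adjoint T)) => //; exact: ler_rnorm_adjoint.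
by apply: (bound2 (adjoint T) T) => //; exact: ler_rnorm_adjoint.
Qed.

(** The left-hand side is [<(TT* + T*T)x, x>]. *)
Lemma sqr_rnormD_adjoint_le x : rnorm x = 1 ->
  rnorm (T x) ^+ 2 + rnorm (adjoint T x) ^+ 2 <= opnorm S.
Proof.
move=> x1.
have -> : rnorm (T x) ^+ 2 + rnorm (adjoint T x) ^+ 2 = Re (inner (S x) x).
  rewrite /S /= innerDl adjointP inner_rnorm [inner _ x]innerC -adjointP.
  rewrite inner_rnorm.
  by rewrite ReD ReJ addrC.
apply: le_trans (ler_Re_rnorm _) (le_trans (ler_rnorm_inner _ _) _).
by rewrite x1 mulr1 ler_rnormS ?x1.
Qed.

Let N := Num.sqrt (opnorm S).

Let sqrN x : rnorm x = 1 -> N ^+ 2 = opnorm S.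
Proof.
move=> x1; rewrite sqr_sqrtr// (le_trans _ (sqr_rnormD_adjoint_le _ x1))//.
by rewrite addr_ge0 ?sqr_ge0.
Qed.

Lemma ler_rnorm_sqrt_opnorm x : rnorm x = 1 -> rnorm (T x) <= N.
Proof.
move=> x1; rewrite -(@ler_pXn2r _ 2) ?nnegrE ?rnorm_ge0 ?sqrtr_ge0//.
by rewrite (sqrN _ x1) (le_trans _ (sqr_rnormD_adjoint_le _ x1))// lerDl sqr_ge0.
Qed.

(** The value [<Tx, x> = <x, T*x>] is at most [|Tx|] and at most [|T*x|] in
    modulus; averaging the squares gains the factor [1 / 2]. *)
Lemma ler_rnorm_inner_diag x : rnorm x = 1 ->
  rnorm (inner (T x) x) <= Num.sqrt 2 / 2 * N.
Proof.
move=> x1; have N0 : 0 <= N by exact: sqrtr_ge0.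
have := sqr_rnormD_adjoint_le _ x1; rewrite -(sqrN _ x1) => h.
have a := ler_rnorm_inner (T x) x.
have := ler_rnorm_inner x (adjoint T x); rewrite -adjointP => b.
rewrite x1 mulr1 in a; rewrite x1 mul1r in b.
have w0 := rnorm_ge0 (inner (T x) x : R[i]^o).
rewrite -(@ler_pXn2r _ 2) ?nnegrE ?mulr_ge0 ?divr_ge0 ?sqrtr_ge0//.
rewrite !exprMn sqr_sqrtr//.
move: h a b w0; set w := rnorm (inner (T x) x); nra.
Qed.

(** The component of [y] along [x] meets the numerical radius bound, the
    orthogonal component [w] meets the norm bound. *)
Lemma q_values_le q r : q_values q T r ->
  r <= (Num.sqrt 2 / 2 * rnorm q + Num.sqrt (1 - rnorm q ^+ 2)) * N.
Proof.
move=> [x [y [x1 y1 xyq ->]]].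
pose w := y - conjC q *: x.
have xx : inner x x = 1 by rewrite inner_rnorm x1 expr1n.
have xw : inner x w = 0.
  by rewrite innerDr innerNr innerZr conjCK xx mulr1 xyq subrr.
have yE : y = w + conjC q *: x by rewrite subrK.
have w2 : rnorm w = Num.sqrt (1 - rnorm q ^+ 2).
  rewrite -[LHS]ger0_norm ?rnorm_ge0// -sqrtr_sqr; congr Num.sqrt.
  have := sqr_rnormD w (conjC q *: x); rewrite -yE y1 rnormZ x1 mulr1 expr1n.
  have -> : rnorm (conjC q) = rnorm q by rewrite /rnorm norm_conjC.
  by rewrite innerZr [inner w x]innerC xw conjC0 mulr0 mulr0; lra.
have -> : inner (T x) y = inner (T x) w + q * inner (T x) x.
  by rewrite {1}yE innerDr innerZr conjCK.
apply: le_trans (@ler_rnormD R R[i]^o _ _) _.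
rewrite (@rnormZ R R[i]^o) mulrDl addrC; apply: lerD.
  by rewrite mulrAC [leRHS]mulrC ler_wpM2l ?ler_rnorm_inner_diag//
    (@rnorm_ge0 R R[i]^o).
rewrite mulrC -w2; apply: le_trans (ler_rnorm_inner _ _) _.
by rewrite ler_wpM2r ?rnorm_ge0 ?ler_rnorm_sqrt_opnorm.
Qed.

End Adjoint.
End Hilbert.

(** * The Hermite-Hadamard inequality *)

Lemma within_continuous_comp_sub (X Y Z : topologicalType) (A : set X)
    (B : set Y) (f : X -> Y) (g : Y -> Z) :
  (forall x, A x -> B (f x)) -> continuous f -> {within B, continuous g} ->
  {within A, continuous (g \o f)}.
Proof.
move=> AB fc /subspace_continuousP gB; apply/subspace_continuousP => x Ax.
apply: cvg_comp _ (gB _ (AB _ Ax)); move=> U /= BU.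
have /= fU := fc x _ BU.
(* The neighbourhoods of x within A, unfolded. *)
suff : nbhs x (fun t => A t -> U (f t)) by [].
by apply: (@filterS _ _ (nbhs_filter x) _ _ _ fU) => t /= tU /AB; exact: tU.
Qed.

Section HermiteHadamard.
Context {R : realType}.
Variable phi : R -> R.
Hypotheses (phi_convex : convex_function (E := R^o) `[0, +oo[ phi)
  (phi_cont : {within `[0, +oo[, continuous phi}).

Lemma convex_function_le x y t : 0 <= x -> 0 <= y -> 0 <= t <= 1 ->
  phi (t * x + (1 - t) * y) <= t * phi x + (1 - t) * phi y.
Proof.
move=> x0 y0 /andP[t0 t1].
have xP : x \in (`[0, +oo[%classic : set R) by rewrite inE/= in_itv/= x0.
have yP : y \in (`[0, +oo[%classic : set R) by rewrite inE/= in_itv/= y0.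
by have := phi_convex (Itv01 t0 t1) x y xP yP; rewrite !convRE/=.
Qed.

Variables a b : R.
Hypotheses (a0 : 0 <= a) (b0 : 0 <= b).

Let G t := phi (t * a + (1 - t) * b).

Let G_cont : {within `[0, 1], continuous G}.
Proof.
rewrite (_ : G = phi \o (fun t : R^o => t * a + (1 - t) * b))//.
apply: (within_continuous_comp_sub R R R _ `[0, +oo[) => //.
  move=> t /=; rewrite !in_itv/= andbT => /andP[t0 t1].
  by rewrite addr_ge0// mulr_ge0// subr_ge0.
move=> t; apply: cvgD; apply: cvgMl; first exact: cvg_id.
by apply: cvgB; [exact: cvg_cst|exact: cvg_id].
Qed.

Let Gsym_cont : {within `[0, 1], continuous (fun t => G (1 - t))}.
Proof.
rewrite (_ : (fun t => G (1 - t)) = G \o (fun t : R^o => 1 - t))//.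
apply: (within_continuous_comp_sub R R R _ `[0, 1]) => //.
  move=> t /=; rewrite !in_itv/= => /andP[t0 t1]; lra.
by move=> t; apply: cvgB; [exact: cvg_cst|exact: cvg_id].
Qed.

Let integrable01 (f : R -> R) : {within `[0, 1], continuous f} ->
  lebesgue_measure.-integrable `[0, 1] (EFin \o f).
Proof.
by move=> fc; apply: continuous_compact_integrable => //; exact: segment_compact.
Qed.

Let Rintegral01_cst c : \int[lebesgue_measure]_(t in `[0, 1]) c = c :> R.
Proof.
by rewrite Rintegral_cst//= lebesgue_measure_itv/= lte01 oppr0 adde0 mulr1.
Qed.

(** The reflection [t |-> 1 - t] replaces the integrand by a symmetric one,
    for which both bounds of the Hermite-Hadamard inequality hold pointwise. *)
Let double_integral :
  2 * \int[lebesgue_measure]_(t in `[0, 1]) G t =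
  \int[lebesgue_measure]_(t in `[0, 1]) (G t + G (1 - t)) :> R.
Proof.
rewrite RintegralD//; [|exact: integrable01..].
have := @Rintegration_by_substitution_onem R G 1 _ G_cont.
rewrite /unstable.onem subrr ler01 lexx => /(_ isT) <-.
by rewrite mulr_natl mulr2n.
Qed.

(** For every [t] in [[0, 1]], the points [t a + (1 - t) b] and
    [(1 - t) a + t b] have midpoint [(a + b) / 2], and the sum of the values of
    [phi] at them is at most [phi a + phi b] by convexity. *)
Lemma hermite_hadamard :
  ((phi (2^-1 * (a + b)))%:E
   <= \int[lebesgue_measure]_(t in `[0%R, 1%R]) (phi (t * a + (1 - t) * b))%:E
   <= (2^-1 * (phi a + phi b))%:E)%E.
Proof.
have -> : (\int[lebesgue_measure]_(t in `[0%R, 1%R]) (G t)%:E =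
    (\int[lebesgue_measure]_(t in `[0%R, 1%R]) G t)%R%:E)%E.
  by rewrite /Rintegral fineK// integrable_fin_num//; exact: integrable01.
rewrite !lee_fin.
have half : 0 <= (2^-1 : R) <= 1 by lra.
have sum_int : lebesgue_measure.-integrable `[0, 1]
    (EFin \o (fun t : R => G t + G (1 - t))).
  by apply: integrable01 => t; apply: cvgD; [exact: G_cont|exact: Gsym_cont].
have cst_int c : lebesgue_measure.-integrable `[0, 1]
    (EFin \o (fun _ : R => c : R)).
  by apply: integrable01 => t; exact: cvg_cst.
apply/andP; split.
  suff : 2 * phi (2^-1 * (a + b)) <=
     \int[lebesgue_measure]_(t in `[0, 1]) (G t + G (1 - t)).
    by rewrite -double_integral; lra.
  rewrite -[leLHS]Rintegral01_cst; apply: le_Rintegral => // t /=.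
  rewrite in_itv/= => /andP[t0 t1].
  have s0 : 0 <= t * a + (1 - t) * b by rewrite addr_ge0 ?mulr_ge0 ?subr_ge0.
  have s1 : 0 <= (1 - t) * a + (1 - (1 - t)) * b.
    by rewrite addr_ge0 ?mulr_ge0 ?subr_ge0// gerBl.
  have := convex_function_le _ _ _ s0 s1 half; rewrite -/(G t) -/(G (1 - t)).
  have -> : 2^-1 * (t * a + (1 - t) * b) +
    (1 - 2^-1) * ((1 - t) * a + (1 - (1 - t)) * b) = 2^-1 * (a + b) by field.
  lra.
suff : \int[lebesgue_measure]_(t in `[0, 1]) (G t + G (1 - t)) <= phi a + phi b.
  by rewrite -double_integral; lra.
rewrite -[leRHS]Rintegral01_cst; apply: le_Rintegral => // t /=.
rewrite in_itv/= => /andP[t0 t1].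
have t01 : 0 <= t <= 1 by rewrite t0.
have s01 : 0 <= 1 - t <= 1 by lra.
have := convex_function_le _ _ _ a0 b0 t01.
have := convex_function_le _ _ _ a0 b0 s01.
rewrite -/(G t) -/(G (1 - t)); lra.
Qed.
End HermiteHadamard.

(** * The bound on the q-numerical radius *)

Theorem theorem1p1 (R : realType) (H : hilbertType R) (T : {linear H -> H})
    (q : R[i]) (phi : R -> R) :
  bounded_operator T ->
  rnorm q <= 1 ->
  q_values q T !=set0 ->
  orlicz phi ->
  let N := Num.sqrt
    (opnorm ((T \o adjoint T) \+ (adjoint T \o T) : H -> H)) in
  ((phi (q_numerical_radius q T))%:E
   <= \int[lebesgue_measure]_(t in `[0%R, 1%R])
        (phi ((Num.sqrt 2 * t * rnorm q
               + 2 * (1 - t) * Num.sqrt (1 - rnorm q ^+ 2)) * N))%:E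
   <= (2^-1 * (phi (Num.sqrt 2 * rnorm q * N)
               + phi (2 * Num.sqrt (1 - rnorm q ^+ 2) * N)))%:E)%E.
Proof.
move=> [M TM] _ q_nonempty [[_ phi_cont phi_convex phi_incr] _ _ _].
lazy zeta; set N := Num.sqrt (opnorm _).
have N0 : 0 <= N by exact: sqrtr_ge0.
have q0 : 0 <= rnorm q by exact: (@rnorm_ge0 R R[i]^o).
set a := Num.sqrt 2 * rnorm q * N; set b := 2 * _ * N.
have a0 : 0 <= a by rewrite !mulr_ge0 ?sqrtr_ge0.
have b0 : 0 <= b by rewrite !mulr_ge0 ?sqrtr_ge0.
have ub r : q_values q T r -> r <= 2^-1 * (a + b).
  move=> /(q_values_le T M TM q r) /le_trans; apply.
  by rewrite -/N /a /b; lra.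
have wq_le : q_numerical_radius q T <= 2^-1 * (a + b) by exact: ge_sup.
(* phi is only known to be monotone on the nonnegative reals. *)
have wq_ge0 : 0 <= q_numerical_radius q T.
  have [r rT] := q_nonempty; apply: le_trans (_ : r <= _); last first.
    by apply: ub_le_sup => //; exists (2^-1 * (a + b)).
  by case: rT => x [y [_ _ _ ->]]; exact: (@rnorm_ge0 R R[i]^o).
have phi_le : phi (q_numerical_radius q T) <= phi (2^-1 * (a + b)).
  by apply: phi_incr => //; rewrite in_itv/= ?wq_ge0// (le_trans wq_ge0).
have /andP[lo hi] := hermite_hadamard phi phi_convex phi_cont a b a0 b0.
rewrite (_ : \int[lebesgue_measure]_(t in _) _ =
  \int[lebesgue_measure]_(t in `[0%R, 1%R]) (phi (t * a + (1 - t) * b)%R)%:E)%E; last first.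
  by apply: eq_integral => t _; congr (phi _)%:E; rewrite /a /b; ring.
by rewrite hi andbT; apply: le_trans lo; rewrite lee_fin.
Qed.
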